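(* Let $p$ be a prime and let $G$ be a finite nonabelian $p$-group that is an NS--group with $d(G) = m$. Then $|G| \geq p^{2m+p+2}$.
   Context: For a finite $p$-group $G$: $\Phi(G)$ is the Frattini subgroup, $Z(H)$ is the center of a group $H$, and $d(G)$ is the minimum number of generators of $G$. The Frattini quotient $Q = G/\Phi(G)$ acts by conjugation on $A = Z(\Phi(G))$. For a finite group $Q$ and a $\mathbb{Z}Q$-module $A$, $\hat{H}^n(Q;A)$ denotes Tate cohomology; in particular $\hat{H}^0(Q;A)$ is $A^Q$ modulo the image of the trace map $a \mapsto \sum_{q\in Q} qa$. A finite nonabelian $p$-group $G$ is called an NS--group if $\hat{H}^0(G/\Phi(G); Z(\Phi(G))) = 0$. *)

(* Defs.v *)
From mathcomp Require Import all_boot all_fingroup all_solvable.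

Set Implicit Arguments.
Unset Strict Implicit.
Unset Printing Implicit Defensive.

Local Open Scope group_scope.

(* A finite abelian group A <= R stable under a group action of Q plays the
   role of the module; it is written multiplicatively. *)
Section TateH0.

Variables (aT rT : finGroupType) (D : {set aT}) (R : {set rT}).
Variable to : groupAction D R.
Variables (Q : {set aT}) (A : {set rT}).

Definition trace (a : rT) : rT := \prod_(q in Q) to a q.

Definition trace_image : {set rT} := trace @: A.

(* When A is an abelian group normalized by Q, trace_image is a subgroup of
   A^Q (see below), so this is the usual quotient A^Q / (image of the trace). *)
Definition Tate_H0 : {set coset_of trace_image} :=
  'Fix_(A | to)(Q) / trace_image.

End TateH0.

Lemma trace_image_group (aT rT : finGroupType) (D : {group aT})
    (R : {group rT}) (to : groupAction D R) (Q : {group aT})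
    (A : {group rT}) :
  Q \subset D -> abelian A -> {acts Q, on group A | to} ->
  group_set (trace_image to Q A) /\
  trace_image to Q A \subset 'Fix_(A | to)(Q).
Proof.
move=> sQD abA [nAQ sAR].
have toA q x : q \in Q -> x \in A -> to x q \in A.
  by move=> Qq; rewrite (acts_act nAQ).
have traceA x : x \in A -> trace to Q x \in A.
  by move=> Ax; apply: group_prod => q Qq; apply: toA.
have traceM x y : x \in A -> y \in A ->
    trace to Q x * trace to Q y = trace to Q (x * y).
  move=> Ax Ay; rewrite /trace.
  suff [] : [/\ \prod_(q in Q) to x q \in A, \prod_(q in Q) to y q \in A
    & (\prod_(q in Q) to x q) * (\prod_(q in Q) to y q) =
      \prod_(q in Q) to (x * y) q] by [].
  apply: (big_rec3 (fun u v w => [/\ u \in A, v \in A & u * v = w])).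
    by rewrite mulg1 group1.
  move=> q u v w Qq [Au Av <-]; rewrite !groupM ?toA //; split=> //.
  rewrite gactM ?(subsetP sAR) ?(subsetP sQD) // !mulgA; congr (_ * _).
  by rewrite -!mulgA; congr (_ * _); apply: (centsP abA); rewrite ?toA.
split.
  apply/group_setP; split.
    apply/imsetP; exists 1; rewrite // /trace big1 // => q Qq.
    by rewrite gact1 ?(subsetP sQD).
  move=> _ _ /imsetP[x Ax ->] /imsetP[y Ay ->].
  by rewrite traceM // imset_f // groupM.
apply/subsetP=> _ /imsetP[x Ax ->]; rewrite inE traceA //=.
apply/afixP=> r Qr; have Dr := subsetP sQD r Qr.
have -> : to (trace to Q x) r = \prod_(q in Q) to x (q * r).
  suff [] : \prod_(q in Q) to x q \in A /\
    to (\prod_(q in Q) to x q) r = \prod_(q in Q) to x (q * r) by [].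
  apply: (big_rec2 (fun u v => u \in A /\ to u r = v)).
    by rewrite group1 gact1.
  move=> q u v Qq [Au <-]; rewrite groupM ?toA //; split=> //.
  by rewrite gactM ?(subsetP sAR) ?toA // actMin ?(subsetP sQD).
have fmodP (f : aT -> rT) : (forall q, q \in Q -> f q \in A) ->
    \prod_(q in Q) f q = FiniteModule.fmval
      (\sum_(q in Q) FiniteModule.fmod abA (f q))%R.
  move=> Af; rewrite FiniteModule.fmval_sum.
  by apply: eq_bigr => q Qq; rewrite [RHS]FiniteModule.fmodK ?Af.
rewrite /trace !fmodP => [||q Qq]; last 2 first.
- by move=> q Qq; apply: toA.
- by apply: toA; rewrite ?groupM.
congr FiniteModule.fmval; rewrite [RHS](reindex_inj (mulIg r)) /=.
by apply: eq_bigl => q; rewrite groupMr.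
Qed.

(* 'J %% 'Phi(G) is the action induced by conjugation on cosets of 'Phi(G),
   which is defined on the centraliser of 'Phi(G), hence on 'Z('Phi(G)). *)
Definition NS_group (p : nat) (gT : finGroupType) (G : {group gT}) : Prop :=
  [/\ p.-group G, ~~ abelian G
    & Tate_H0 ('J %% 'Phi(G))%gact (G / 'Phi(G)) 'Z('Phi(G)) = 1].

Lemma NS_actionE (gT : finGroupType) (G : {group gT}) (a g : gT) :
  a \in 'Z('Phi(G)) -> g \in G ->
  ('J %% 'Phi(G))%gact a (coset 'Phi(G) g) = a ^ g.
Proof.
case/centerP=> Pa cPa Gg; rewrite /= modactE ?inE //.
  by have /normsP/(_ g Gg)-> : G \subset 'N('Phi(G)) by apply: gFnorm.
apply/subsetP=> h /setIP[_ Ph]; rewrite inE /=.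
by rewrite conjgE (cPa h Ph) mulKg.
Qed.

(* Main.v *)
Require Import Defs.
From mathcomp Require Import all_boot all_fingroup all_solvable.
From mathcomp Require Import ssralg finalg.

(** Write A = Z(Phi(G)), a module over the elementary abelian group
    Q = G / Phi(G). The bound is the product of |Q| = p ^ m,
    |Phi(G) / A| >= p ^ 2 and |A| >= p ^ p * |Q|.

    The last two factors rest on the fact that the vanishing of the Tate group
    in degree 0 passes to subgroups (H0_trivial_sub, an elementary case of the
    Gaschuetz-Uchida theorem): if H has prime index in K, the submodule T of
    H-traces and the module of H-fixed points B have the same K-fixed points,
    these are traces from T, and then a Herbrand quotient count on the cyclic
    group K / H leaves no nonzero fixed point in B / T, so that B = T.

    The bound on |A| (card_H0_trivial_abelem). Fixed points grow at least by
    the index (card_fix_index), since otherwise the trace would be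
    multiplication by p on a nontrivial p-group and still surjective. So for
    z of order p the map delta = z - 1 has kernel of order at least |Q|. If
    |A| < p ^ p * |Q|, then |delta A| < p ^ p, and as the images of the powers
    of delta strictly decrease, delta ^ p = 0 and delta ^ (p - 1) A has order
    at most p. Expanding z ^ p - 1 and the trace in powers of delta gives
    p delta = 0 and tr z = p + delta ^ (p - 1). Both pA and delta ^ (p - 1) A
    are fixed by all of Q, hence so is every trace, that is every fixed point
    of z, against the strict growth of fixed points when |Q| > p.

    The bound on |Phi(G) / A| (Phi_nonabelian). The quotient of a nonabelian
    group by its center is not cyclic, so it is enough that Phi(G) is not
    abelian. If it were, Phi(G) = A; for x outside A, the element x ^ p of A is
    fixed by x, hence is a trace, and x can be changed by an element of A into
    y with y ^ p = 1. For g in G the commutator [y, g] has trivial y-trace, so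
    by the Herbrand count again it lies in [A, y]. Modulo a normal subgroup A0
    of G of index p in A, the group G is thus elementary abelian, and
    Phi(G) <= A0 < A = Phi(G). *)

Set Implicit Arguments.
Unset Strict Implicit.
Unset Printing Implicit Defensive.

Import GRing.Theory FinRing.Theory.

(** * Additive maps on finite abelian groups *)

Section AdditiveMaps.

Local Open Scope group_scope.
Local Open Scope ring_scope.

Variable V : finZmodType.
Implicit Types (f : V -> V) (S : {group V}) (u v : V).

Lemma groupB S u v : u \in S -> v \in S -> u - v \in S.
Proof. by move=> Su Sv; apply: groupM; rewrite ?groupV. Qed.

Lemma group_sum I (r : seq I) (P : pred I) (F : I -> V) S :
  (forall i, P i -> F i \in S) -> \sum_(i <- r | P i) F i \in S.
Proof.
by move=> SF; elim/big_rec: _ => [|i u Pi Su]; [apply: group1 | apply/groupM/Su/SF].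
Qed.

Lemma im_group_set f S : {morph f : u v / u + v} -> group_set (f @: S).
Proof.
move=> fD.
have fM : {in S &, {morph f : u v / (u * v)%g}} by move=> u v _ _; apply: fD.
have -> : f @: S = Morphism fM @* S by rewrite morphimEdom.
exact: groupP.
Qed.

Lemma card_im_ker f S :
  {morph f : u v / u + v} -> (#|f @: S| * #|[set v in S | f v == 0%R]|)%N = #|S|.
Proof.
move=> fD.
have fM : {in S &, {morph f : u v / (u * v)%g}} by move=> u v _ _; apply: fD.
pose h := Morphism fM.
have -> : f @: S = h @* S by rewrite morphimEdom.
have -> : [set v in S | f v == 0] = 'ker h.
  by apply/setP=> v; rewrite !inE.
by rewrite card_morphim setIid mulnC Lagrange ?subsetIl.
Qed.

End AdditiveMaps.

(** * Subgroups of prime index *)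

Section PrimeIndex.

Local Open Scope group_scope.

Lemma index_prime_exists (gT : finGroupType) (H K : {group gT}) :
  prime #|K : H| -> exists c, c \in K :\: H.
Proof.
move=> prKH; apply/set0Pn; apply: contraTneq prKH => /eqP; rewrite setD_eq0 => sKH.
by have /eqP-> : #|K : H| == 1%N; rewrite ?indexg_eq1.
Qed.

Lemma index_prime_gen (gT : finGroupType) (H K : {group gT}) (c : gT) :
  H \subset K -> prime #|K : H| -> c \in K :\: H -> H <*> <[c]> = K.
Proof.
move=> sHK prKH /setDP[Kc H'c]; set M := (H <*> <[c]>)%G.
have sMK : M \subset K by rewrite join_subG sHK cycle_subG.
have sHM : H \subset M := joing_subl H <[c]>.
apply/eqP; rewrite eqEsubset sMK /= -indexg_eq1.
have := dvdn_mulr #|M : H| (dvdnn #|K : M|); rewrite Lagrange_index //.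
case/primeP: prKH => _ prKH /prKH /orP[// | /eqP eqKM].
have: #|M : H| == 1%N.
  by rewrite -(eqn_pmul2l (indexg_gt0 K M)) Lagrange_index // muln1 eqKM.
rewrite indexg_eq1 => sMH; case/negP: H'c; apply: (subsetP sMH).
by rewrite mem_gen // inE cycle_id orbT.
Qed.

End PrimeIndex.

(** * Traces and fixed points in finite modules *)

Section Modules.

Local Open Scope group_scope.
Local Open Scope ring_scope.

Variables (p : nat) (qT : finGroupType) (V : finZmodType).
Variable to : {action qT &-> V}.
Hypothesis toD : forall x, {morph to^~ x : u v / u + v}.
Implicit Types (H K : {group qT}) (S : {group V}) (x z : qT) (u v : V).

Lemma to0 x : to 0 x = 0.
Proof. by apply: (addrI (to 0 x)); rewrite -toD !addr0. Qed.

Lemma toN x : {morph to^~ x : u / - u}.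
Proof. by move=> u; apply: (addrI (to u x)); rewrite -toD !subrr to0. Qed.

Lemma toB x : {morph to^~ x : u v / u - v}.
Proof. by move=> u v; rewrite toD toN. Qed.

Definition to_sum x := big_morph (to^~ x) (toD x) (to0 x).

Definition mtrace (H : {set qT}) v := \sum_(h in H) to v h.
Definition delta x v := to v x - v.

(** Vanishing of the Tate group in degree 0, without forming the quotient. *)
Definition H0_trivial (H : {set qT}) := 'Fix_to(H) \subset mtrace H @: [set: V].

Lemma mtraceD (H : {set qT}) : {morph mtrace H : u v / u + v}.
Proof. by move=> u v; rewrite -big_split; apply: eq_bigr => h _; rewrite toD. Qed.

Lemma deltaD x : {morph delta x : u v / u + v}.
Proof. by move=> u v; rewrite /delta toD opprD addrACA. Qed.

Lemma deltaB x : {morph delta x : u v / u - v}.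
Proof. by move=> u v; rewrite /delta toB !opprD addrACA. Qed.

Lemma fix_group_set (H : {set qT}) : group_set 'Fix_to(H).
Proof.
apply/group_setP; split=> [|u v /afixP fu /afixP fv]; apply/afixP=> h Hh.
  exact: to0.
by rewrite zmodMgE toD fu ?fv.
Qed.
Canonical fix_group H := Group (fix_group_set H).

(** This is the trace of <[x]> when n is the order of x; for larger orders of x
    it is used on modules where x ^+ n acts trivially. *)
Definition powsum n x v := \sum_(i < n) to v (x ^+ i)%g.

Lemma powsumD n x : {morph powsum n x : u v / u + v}.
Proof. by move=> u v; rewrite -big_split; apply: eq_bigr => h _; rewrite toD. Qed.

Lemma powsum_delta n x v : powsum n x (delta x v) = to v (x ^+ n)%g - v.
Proof.
rewrite /powsum; elim: n => [|n IHn]; first by rewrite big_ord0 act1 subrr.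
by rewrite big_ord_recr /= IHn /delta toB -actM -expgS addrC addrA subrK.
Qed.

Lemma delta_powsum n x v : delta x (powsum n x v) = to v (x ^+ n)%g - v.
Proof.
rewrite -powsum_delta /delta /powsum to_sum -sumrB; apply: eq_bigr => i _.
by rewrite toB -!actM -expgS -expgSr.
Qed.

(** For a cyclic group acting on a finite module, the Tate groups of degrees 0
    and -1 have the same order: the norm N and delta have images contained in
    each other's kernels, and |S| is the product of the orders of the image and
    of the kernel of either map. *)
Lemma ker_powsum n x S v :
    {in S, forall u, to u x \in S} -> {in S, forall u, to u (x ^+ n)%g = u} ->
    [set u in S | delta x u == 0] \subset powsum n x @: S ->
  v \in S -> powsum n x v = 0 -> v \in delta x @: S.
Proof.
move=> xS xn1 sKI Sv Nv0.
have toS u i : u \in S -> to u (x ^+ i)%g \in S.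
  by move=> Su; elim: i => [|i IHi]; rewrite ?act1 // expgSr actM xS.
have eqKI : [set u in S | delta x u == 0] = powsum n x @: S.
  apply/eqP; rewrite eqEsubset sKI; apply/subsetP=> _ /imsetP[u Su ->].
  by rewrite inE delta_powsum xn1 // subrr eqxx andbT group_sum // => i _; apply: toS.
have sIK : delta x @: S \subset [set u in S | powsum n x u == 0].
  apply/subsetP=> _ /imsetP[u Su ->].
  rewrite inE powsum_delta xn1 // subrr eqxx andbT.
  by apply: groupB => //; apply: xS.
suff /eqP-> : delta x @: S == [set u in S | powsum n x u == 0].
  by rewrite inE Sv Nv0 /=.
pose N := Group (im_group_set S (powsumD n x)).
rewrite eqEcard sIK -(leq_pmul2l (cardG_gt0 N)) /=.
rewrite card_im_ker -?eqKI 1?mulnC ?card_im_ker //.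
  exact: deltaD.
exact: powsumD.
Qed.

(** The powers of c form a transversal of H in K, so the trace of K is the trace
    of H followed by the norm of the cyclic quotient K / H. *)
Lemma mtrace_index_prime H K c v :
    H <| K -> prime #|K : H| -> c \in K :\: H ->
  mtrace K v = powsum #|K : H| c (mtrace H v).
Proof.
move=> nsHK prKH /setDP[Kc H'c]; set q := #|K : H| in prKH *.
have [sHK nHK] := andP nsHK; have Nc := subsetP nHK c Kc.
have ocH : #[coset H c] = q.
  have: #[coset H c] %| q by rewrite /q -card_quotient // order_dvdG ?mem_quotient.
  case/primeP: prKH => _ prq /prq /orP[|/eqP //]; rewrite order_eq1 => /eqP.
  by move/(coset_idr Nc); rewrite (negPf H'c).
have Hcn n : (c ^+ n \in H)%g = (q %| n)%N.
  rewrite -ocH order_dvdn -morphX //.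
  apply/idP/eqP=> [/coset_id // | /coset_idr-> //].
  by rewrite groupX.
pose g (iu : 'I_q * qT) := (iu.2 * c ^+ iu.1)%g.
pose D : {set 'I_q * qT} := setX setT H.
have injg : {in D &, injective g}.
  suff inj_le i j h k : h \in H -> k \in H -> i <= j -> j < q ->
      (h * c ^+ i = k * c ^+ j)%g -> i = j /\ h = k.
    case=> [i h] [j k]; rewrite !inE /= => Hh Hk; rewrite /g /= => eq_hk.
    case/orP: (leq_total i j) => le_ij.
      by have [/val_inj-> ->] := inj_le _ _ _ _ Hh Hk le_ij (ltn_ord _) eq_hk.
    by have [/val_inj-> ->] := inj_le _ _ _ _ Hk Hh le_ij (ltn_ord _) (esym eq_hk).
  move=> Hh Hk leij ltjq eq_hk.
  have cji : (c ^+ (j - i) = k^-1 * h)%g.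
    apply: (mulgI k); rewrite mulKVg; apply: (mulIg (c ^+ i)%g).
    by rewrite -mulgA -expgD subnK.
  have: (q %| j - i)%N by rewrite -Hcn cji groupM ?groupV.
  case: (posnP (j - i)) => [/eqP | lt0 /(dvdn_leq lt0)]; last first.
    by rewrite leqNgt (leq_ltn_trans (leq_subr i j) ltjq).
  rewrite subn_eq0 => leji _; have eij : i = j by apply/eqP; rewrite eqn_leq leij.
  by split=> //; apply: (mulIg (c ^+ i)%g); rewrite eq_hk eij.
have imD : g @: D = K.
  apply/eqP; rewrite eqEcard card_in_imset // cardsX cardsT card_ord.
  rewrite mulnC Lagrange // leqnn andbT.
  apply/subsetP=> _ /imsetP[[i h] /setXP[_ /= Hh] ->].
  by rewrite groupM ?groupX // (subsetP sHK).
rewrite /mtrace /powsum -imD big_imset //=; under [RHS]eq_bigr do rewrite to_sum.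
rewrite pair_big /=; apply: eq_big => [[i h] | [i h] _] /=; last by rewrite actM.
by rewrite inE /= inE.
Qed.

(** * Vanishing in degree 0 and orders of fixed point modules *)

Hypotheses (p_pr : prime p) (pQ : p.-group [set: qT]) (pV : p.-group [set: V]).

Let pH H : p.-group H. Proof. exact: pgroupS (subsetT H) pQ. Qed.
Let pS S : p.-group S. Proof. exact: pgroupS (subsetT S) pV. Qed.

Lemma card_fix_ge H S :
  [acts H, on S | to] -> S :!=: 1%g -> p <= #|'Fix_(S | to)(H)|.
Proof.
move=> nSH ntS; apply: dvdn_leq.
  by apply/card_gt0P; exists 0; rewrite inE group1; apply: (group1 (fix_group H)).
have [_ p_dv_S _] := pgroup_pdiv (pS S) ntS.
by rewrite /dvdn -(pgroup_fix_mod (pH H) nSH).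
Qed.

(** The kernel of delta consists of the fixed points of x, and a p-group has
    nontrivial fixed points on a nontrivial p-group. *)
Lemma card_im_delta x S :
  {in S, forall u, to u x \in S} -> S :!=: 1%g -> p * #|delta x @: S| <= #|S|.
Proof.
move=> xS ntS; rewrite -(card_im_ker S (deltaD x)) mulnC leq_mul2l.
have nSx : [acts <[x]>, on S | to].
  by rewrite cycle_subG !inE; apply/subsetP=> u Su; rewrite inE xS.
apply/orP; right; apply: leq_trans (card_fix_ge nSx ntS) (subset_leq_card _).
apply/subsetP=> u /setIP[Su /afixP/(_ x (cycle_id x)) xu].
by rewrite inE Su /delta xu subrr /=.
Qed.

Lemma card_iter_delta x S n k :
    {in S, forall u, to u x \in S} -> #|S| <= p ^ (n + k) ->
  #|iter n (delta x) @: S| <= p ^ k.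
Proof.
elim: n S => [|n IHn] S xS leS.
  by rewrite (eq_imset _ (fun v => erefl v)) imset_id.
have -> : iter n.+1 (delta x) @: S = iter n (delta x) @: (delta x @: S).
  by rewrite -imset_comp; apply: eq_imset => v; rewrite iterSr.
pose T := Group (im_group_set S (deltaD x)).
apply: (IHn T) => /= [_ /imsetP[u Su ->]|].
  by rewrite /delta toB; apply/imsetP; exists (to u x); first exact: xS.
have [S1 | ntS] := eqVneq (S : {set V}) 1%g.
  by rewrite (leq_trans (leq_imset_card _ _)) // S1 cards1 expn_gt0 prime_gt0.
by rewrite -(leq_pmul2l (prime_gt0 p_pr)) -expnS (leq_trans (card_im_delta xS ntS)).
Qed.

Lemma iter_delta0 x S n v :
    {in S, forall u, to u x \in S} -> #|S| <= p ^ n -> v \in S ->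
  iter n (delta x) v = 0.
Proof.
move=> xS leS Sv; have xn0: #|iter n (delta x) @: S| <= p ^ 0.
  by rewrite card_iter_delta ?addn0.
have iter0 : iter n (delta x) 0 = 0.
  by elim: n {leS xn0} => //= n ->; rewrite /delta to0 subrr.
rewrite -[RHS]iter0; apply: (card_le1_eqP xn0); apply: imset_f => //.
exact: group1.
Qed.

Lemma mtrace_act H x v : x \in 'N(H) -> to (mtrace H v) x = mtrace H (to v x).
Proof.
move=> Nx; rewrite /mtrace to_sum [RHS](reindex_inj (conjg_inj x)) /=.
apply: eq_big => [h | h _]; first by rewrite memJ_norm.
by rewrite -!actM -conjgC.
Qed.

Lemma mtrace_fix H v : mtrace H v \in 'Fix_to(H).
Proof.
apply/afixP=> x Hx; rewrite /mtrace to_sum [RHS](reindex_inj (mulIg x)) /=.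
by apply: eq_big => [h | h _]; rewrite ?groupMr // actM.
Qed.

Lemma fix_act H x v : x \in 'N(H) -> v \in 'Fix_to(H) -> to v x \in 'Fix_to(H).
Proof.
move=> Nx /afixP fv; apply/afixP=> h Hh.
by rewrite -actM conjgCV actM fv // memJ_norm ?groupV.
Qed.

(** Any K-fixed point is a norm of an H-trace, so T = mtrace H V has trivial
    cohomology for the cyclic group K / H; by [ker_powsum] any H-fixed u with
    delta u in T then lies in T. As delta is nilpotent, T contains all H-fixed
    points. *)
Lemma H0_trivial_index_prime H K :
  H <| K -> prime #|K : H| -> H0_trivial K -> H0_trivial H.
Proof.
move=> nsHK prKH tK; have [sHK nHK] := andP nsHK.
have [c KH'c] := index_prime_exists prKH.
have mtraceK v := mtrace_index_prime v nsHK prKH KH'c.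
set q := #|K : H| in prKH mtraceK.
have /setDP[Kc _] := KH'c; have Nc := subsetP nHK c Kc.
have Hcq : (c ^+ q)%g \in H.
  apply: coset_idr; first by rewrite groupX.
  by rewrite morphX // /q -card_quotient // expg_cardG // mem_quotient.
pose T := Group (im_group_set [set: V]%G (mtraceD H)).
have cT : {in T, forall u, to u c \in T}.
  by move=> _ /imsetP[u _ ->]; rewrite mtrace_act // imset_f.
have sTF u : u \in T -> u \in 'Fix_to(H) by case/imsetP=> v _ ->; apply: mtrace_fix.
have cqF u : u \in 'Fix_to(H) -> to u (c ^+ q)%g = u by move/afixP->.
have FKc u : u \in 'Fix_to(H) -> delta c u = 0 -> u \in powsum q c @: T.
  move=> Fu cu0; have /(subsetP tK)/imsetP[v _ ->] : u \in 'Fix_to(K).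
    rewrite -(index_prime_gen sHK prKH KH'c) afixYin ?subsetT // afix_cycle.
    by rewrite inE Fu; apply/afix1P/eqP; rewrite -subr_eq0; apply/eqP.
  by rewrite mtraceK imset_f ?imset_f.
have sDT u : u \in 'Fix_to(H) -> delta c u \in T -> u \in T.
  move=> Fu Tcu; have /imsetP[t Tt ct] : delta c u \in delta c @: T.
    apply: (@ker_powsum q) => //.
    - by move=> v /sTF/cqF.
    - by apply/subsetP=> v /setIdP[Tv /eqP cv0]; apply: FKc; rewrite ?sTF.
    by rewrite powsum_delta cqF ?subrr.
  have Fut : u - t \in 'Fix_to(H).
    by apply: (groupB (S := fix_group H)); last exact: sTF.
  have cut : delta c (u - t) = 0 by rewrite deltaB ct subrr.
  have /imsetP[w Tw def_w] := FKc _ Fut cut.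
  rewrite -(subrK t u) def_w; apply: groupM => //.
  apply: group_sum => i _.
  by elim: (i : nat) => [|j IHj]; rewrite ?act1 // expgSr actM cT.
apply/subsetP=> u Fu.
have FD n : iter n (delta c) u \in 'Fix_to(H).
  elim: n => //= n Fn; apply: (groupB (S := fix_group H)) => //.
  exact: fix_act.
pose n := logn p #|[set: V]|; suff: iter n (delta c) u \in T.
  by elim: n => //= n IHn Tn; apply/IHn/sDT.
rewrite (@iter_delta0 _ [set: V]%G) ?inE ?group1 //.
  by move=> w _; rewrite inE.
by rewrite /n -(card_pgroup pV).
Qed.

Lemma p_group_series_ind (P : {group qT} -> {group qT} -> Prop) :
    (forall H, P H H) ->
    (forall H (M : {group qT}) K,
       H \subset M -> M <| K -> #|K : M| = p -> P H M -> P H K) ->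
  forall H K, H \subset K -> P H K.
Proof.
move=> P0 PS H K; have [n] := ubnP #|K|; elim: n K => // n IHn K /ltnSE leK sHK.
have [/group_inj<- // | neHK] := eqVneq (H : {set qT}) K.
case: (maximal_exists sHK) => [eHK | [M maxM sHM]]; first by rewrite eHK eqxx in neHK.
apply: (PS _ M) => //; first exact: p_maximal_normal maxM.
  exact: p_maximal_index maxM.
by apply: IHn => //; case/maxgroupP: maxM => /proper_card ltM _; apply: leq_trans leK.
Qed.

Lemma H0_trivial_sub H K : H \subset K -> H0_trivial K -> H0_trivial H.
Proof.
apply: (p_group_series_ind (P := fun H K => H0_trivial K -> H0_trivial H)) => //.
move=> {}H M {}K sHM nsMK iMK IH tK; apply: IH.
by apply: H0_trivial_index_prime nsMK _ tK; rewrite iMK.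
Qed.

(** If H and K had the same fixed points, the trace of K would be multiplication
    by p on the H-traces, and multiplication by p would map the fixed points of
    K onto themselves; but they contain an element of order p. *)
Lemma card_fix_index_prime H K :
    H <| K -> #|K : H| = p -> H0_trivial K -> 'Fix_to(K) != 1%g ->
  p * #|'Fix_to(K)| <= #|'Fix_to(H)|.
Proof.
move=> nsHK iHK tK ntFK; have sHK := normal_sub nsHK.
have sFF : 'Fix_to(K) \subset 'Fix_to(H) by apply: afixS.
rewrite -(Lagrange (G := fix_group H) (H := fix_group K)) // mulnC leq_mul2l.
apply/orP; right.
have pFF := pnat_dvd (dvdn_indexg _ (fix_group K)) (pS (fix_group H)).
case/p_natP: pFF => [[|k] ik]; last first.
  by rewrite ik -{1}(expn1 p) leq_exp2l ?prime_gt1.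
have eqF : 'Fix_to(H) = 'Fix_to(K).
  apply/eqP; rewrite eqEsubset sFF andbT.
  by rewrite -(indexg_eq1 (fix_group H) (fix_group K)) ik.
have prKH : prime #|K : H| by rewrite iHK.
have [c KH'c] := index_prime_exists prKH; have /setDP[Kc _] := KH'c.
pose f v := v *+ p; have fD : {morph f : u v / u + v} by move=> u v; apply: mulrnDl.
have sFf : 'Fix_to(K) \subset f @: fix_group K.
  apply/subsetP=> _ /(subsetP tK)/imsetP[v _ ->].
  rewrite (mtrace_index_prime v nsHK prKH KH'c) iHK.
  have FKv : mtrace H v \in fix_group K by rewrite /= -eqF mtrace_fix.
  apply/imsetP; exists (mtrace H v) => //.
  rewrite /powsum (eq_bigr (fun=> mtrace H v)) ?sumr_const ?card_ord // => i _.
  by move/afixP: FKv => -> //; rewrite groupX.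
have [_ p_dv_F _] := pgroup_pdiv (pS (fix_group K)) ntFK.
have [v Fv ov] := Cauchy p_pr p_dv_F.
have := card_im_ker (fix_group K) fD.
suff: 1 < #|[set w in fix_group K | f w == 0]|.
  move=> gt1 eq_card; move: (subset_leq_card sFf).
  rewrite -eq_card leqNgt ltn_Pmulr //.
  exact: leq_trans (cardG_gt0 (fix_group K)) (subset_leq_card sFf).
have v0 : v != 0.
  by apply: contraTneq (prime_gt1 p_pr) => v0; rewrite -ov v0 (order1 V).
apply/card_gt1P; exists v, 0; split=> //; apply/setIdP; rewrite /f.
  by rewrite -ov -zmodXgE expg_order.
by rewrite mul0rn; split=> //; apply: (group1 (fix_group K)).
Qed.

Lemma card_fix_index H K :
    H \subset K -> H0_trivial K -> 'Fix_to(K) != 1%g ->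
  #|K : H| * #|'Fix_to(K)| <= #|'Fix_to(H)|.
Proof.
apply: (p_group_series_ind (P := fun H K => H0_trivial K ->
    'Fix_to(K) != 1%g -> #|K : H| * #|'Fix_to(K)| <= #|'Fix_to(H)|)).
  by move=> {}H _ _; rewrite indexgg mul1n.
move=> {}H M {}K sHM nsMK iMK IH tK ntF; have sMK := normal_sub nsMK.
have ntFM : 'Fix_to(M) != 1%g.
  by apply: contraNneq ntF => F1; rewrite -subG1 -F1 afixS.
have leFM := card_fix_index_prime nsMK iMK tK ntF.
rewrite -(Lagrange_index sMK sHM) iMK -mulnA mulnCA.
by apply: leq_trans (IH (H0_trivial_sub sMK tK) ntFM); rewrite leq_mul2l leFM orbT.
Qed.

Lemma iter_deltaD n x : {morph iter n (delta x) : u v / u + v}.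
Proof. by elim: n => // n IHn u v; rewrite /= IHn deltaD. Qed.

Lemma iter_delta_act n x y v :
  commute x y -> to (iter n (delta x) v) y = iter n (delta x) (to v y).
Proof.
by move=> cxy; elim: n => // n IHn; rewrite /= /delta toB -!IHn -!actM cxy.
Qed.

(** This is the identity (x ^ n - 1) / (x - 1) = \sum_i C(n, i + 1) (x - 1) ^ i. *)
Lemma powsum_binom n x v :
  powsum n x v = \sum_(i < n) iter i (delta x) v *+ 'C(n, i.+1).
Proof.
elim: n v => [|n IHn] v; first by rewrite /powsum !big_ord0.
have -> : powsum n.+1 x v = powsum n x v + (v + powsum n x (delta x v)).
  by rewrite powsum_delta [v + _]addrC subrK /powsum big_ord_recr.
under [RHS]eq_bigr do rewrite binS mulrnDr.
rewrite big_split /= !IHn big_ord_recr /= bin_small // mulr0n addr0; congr (_ + _).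
rewrite big_ord_recl /= bin0 mulr1n; congr (_ + _).
by apply: eq_bigr => i _; rewrite -iterSr.
Qed.

Lemma powsum_prime x v :
    (forall i, 0 < i -> iter i (delta x) v *+ p = 0) ->
  powsum p x v = v *+ p + iter p.-1 (delta x) v.
Proof.
move=> pd0; rewrite powsum_binom; have := prime_gt1 p_pr.
case def_p: p => [|[|q]] // _.
rewrite big_ord_recl big_ord_recr /= bin1 binn mulr1n big1 ?add0r // => i _.
have /dvdnP[k ->] : q.+2 %| 'C(q.+2, (bump 0 i).+1).
  by apply: prime_dvd_bin; rewrite -?def_p //= def_p /bump /= add1n !ltnS.
by rewrite mulnC mulrnA -def_p (pd0 (0 + i).+1) ?mul0rn.
Qed.

(** Modulo higher powers of delta, x ^ p - 1 = 0 reads p delta = 0; descending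
    induction on j kills p delta ^ j for all j > 0. *)
Lemma mulrp_delta x v :
    (forall u, to u (x ^+ p)%g = u) -> (forall u, iter p (delta x) u = 0) ->
  delta x v *+ p = 0.
Proof.
move=> xp1 dp0.
suff pd0 k j u : 0 < j -> p <= j + k -> iter j (delta x) u *+ p = 0.
  by apply: (pd0 p 1%N); rewrite ?leq_addl.
elim: k j u => [|k IHk] j u j_gt0 lepj.
  rewrite addn0 in lepj; rewrite -(subnKC lepj) iterD dp0.
  by rewrite mul0rn.
have: powsum p x (iter j (delta x) u) = 0.
  by rewrite -(prednK j_gt0) /= powsum_delta xp1 subrr.
rewrite powsum_prime => [|i i_gt0]; last first.
  rewrite -iterD IHk ?addn_gt0 ?i_gt0 // (leq_trans lepj) //.
  by rewrite addnS -addSn leq_add2r -add1n leq_add2r.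
have eq_pj : (p.-1 + j = p + j.-1)%N.
  by rewrite -{1}(prednK j_gt0) addnS -addSn prednK ?prime_gt0.
by rewrite -iterD eq_pj iterD dp0 addr0.
Qed.

Lemma mtrace_cycle z v : prime #[z] -> mtrace <[z]> v = powsum #[z] z v.
Proof.
move=> pr_z; rewrite (@mtrace_index_prime 1%G <[z]>%G z) ?indexg1 ?normal1 //.
  by rewrite /mtrace big_set1 act1.
by rewrite !inE cycle_id andbT; apply: contraTneq pr_z => ->; rewrite order1.
Qed.

Theorem card_H0_trivial_abelem :
    p.-abelem [set: qT] -> p < #|qT| -> [set: V] != 1%g -> H0_trivial [set: qT] ->
  p ^ p * #|qT| <= #|V|.
Proof.
move=> abQ ltpQ ntV tQ; have p_gt1 := prime_gt1 p_pr.
have [cQQ Qp1] := abelemP p_pr abQ.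
have xp1 x : (x ^+ p)%g = 1%g by apply: Qp1; rewrite inE.
have com (x y : qT) : commute x y by apply: (centsP cQQ); rewrite inE.
have FQ_ge : p <= #|'Fix_to([set: qT])|.
  rewrite -['Fix_to(_)]setTI; apply: (@card_fix_ge [set: qT]%G [set: V]%G) => //.
  by apply/subsetP=> x _; rewrite !inE; apply/subsetP=> v _; rewrite !inE.
have ntF : 'Fix_to([set: qT]) != 1%g.
  by apply: contraTneq FQ_ge => ->; rewrite cards1 -ltnNge.
rewrite leqNgt; apply/negP=> ltV.
have oz (z : qT) : z != 1%g -> #[z] = p.
  by move=> ntz; apply: (abelem_order_p abQ); rewrite ?inE.
have leF z : #|[set: qT] : <[z]>| * #|'Fix_to([set: qT])| <= #|'Fix_to(<[z]>)|.
  exact: card_fix_index (subsetT _) tQ ntF.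
(* ker (delta z) is the fixed point module of z, of order at least |Q|. *)
have le_dV z : z != 1%g -> #|delta z @: [set: V]| <= p ^ p.-1.
  move=> ntz; have: #|delta z @: [set: V]| < p ^ p.
    have := card_im_ker [set: V]%G (deltaD z) => /=.
    have -> : [set v in [set: V] | delta z v == 0] = 'Fix_to(<[z]>).
      by apply/setP=> v; rewrite afix_cycle inE in_setT /= subr_eq0; apply/eqP/afix1P.
    rewrite cardsT => eqV; rewrite -eqV in ltV.
    have leQF : #|qT| <= #|'Fix_to(<[z]>)|.
      apply: leq_trans (leF z); rewrite -cardsT -(Lagrange (subsetT <[z]>)) mulnC.
      by rewrite -orderE oz // leq_mul2l FQ_ge orbT.
    rewrite ltnNge; apply/negP=> lepd; move: ltV; rewrite ltnNge.
    by rewrite leq_mul.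
  have /p_natP[k ->] := pS (Group (im_group_set [set: V]%G (deltaD z))).
  by rewrite ltn_exp2l // leq_exp2l // => ltkp; rewrite -ltnS prednK ?prime_gt0.
have cV z u : u \in delta z @: [set: V] -> forall x, to u x \in delta z @: [set: V].
  case/imsetP=> v _ -> x; rewrite (iter_delta_act 1) ?com //.
  by apply: imset_f; rewrite inE.
pose dV z := Group (im_group_set [set: V]%G (deltaD z)).
have dp0 z v : z != 1%g -> iter p (delta z) v = 0.
  move=> ntz; rewrite -(prednK (prime_gt0 p_pr)) iterSr.
  apply: (@iter_delta0 z (dV z)); rewrite ?le_dV //= ?imset_f ?inE //.
  by move=> u /cV.
have pd0 w v : delta w v *+ p = 0.
  have [-> | ntw] := eqVneq w 1%g; first by rewrite /delta act1 subrr mul0rn.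
  by apply: mulrp_delta => u; rewrite ?xp1 ?act1 ?dp0.
have [z _ ntz] : exists2 z : qT, z \in [set: qT] & z != 1%g.
  by apply/trivgPn; rewrite trivg_card1 cardsT neq_ltn (ltn_trans p_gt1) ?orbT.
(* A fixed point of z is a trace p v + delta ^ (p - 1) v; the first term is
   killed by delta w since p * delta w = 0, and the second lies in a submodule S
   of order at most p, on which the p-group Q acts trivially. *)
have sFz : 'Fix_to(<[z]>) \subset 'Fix_to([set: qT]).
  apply/subsetP=> _ /(subsetP (H0_trivial_sub (subsetT _) tQ))/imsetP[v _ ->].
  apply/afixP=> w _; apply/eqP; rewrite -subr_eq0 -/(delta w _).
  rewrite mtrace_cycle oz // powsum_prime => [|[|i] // _]; last by rewrite /= pd0.
  rewrite deltaD; apply/eqP.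
  have -> : delta w (v *+ p) = 0.
    rewrite -(pd0 w v); elim: (p) => [|n IHn]; first by rewrite /delta to0 subrr.
    by rewrite !mulrS deltaD IHn.
  rewrite add0r.
  pose S := Group (im_group_set [set: V]%G (iter_deltaD p.-1 z)).
  apply: (@iter_delta0 w S 1) => [_ /imsetP[u _ ->] | | ] /=.
  - by rewrite iter_delta_act ?com // imset_f ?inE.
  - have -> : iter p.-1 (delta z) @: [set: V] = iter p.-2 (delta z) @: dV z.
      rewrite -imset_comp; apply: eq_imset => u.
      by rewrite /= -iterSr prednK // -ltnS prednK // prime_gt0.
    apply: card_iter_delta => [u /cV // | ]; rewrite addn1 prednK ?le_dV //.
    by rewrite -ltnS prednK // prime_gt0.
  by rewrite imset_f ?inE.
have := leq_trans (leF z) (subset_leq_card sFz).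
rewrite -{2}[#|'Fix_to(_)|]mul1n leq_pmul2r ?(leq_trans (prime_gt0 p_pr)) //.
rewrite leqNgt => /negP[]; rewrite -(ltn_pmul2l (prime_gt0 p_pr)) muln1.
by rewrite -{2}(oz z ntz) orderE Lagrange ?subsetT // cardsT.
Qed.

End Modules.

(** * The additive module attached to a group action *)

Section ActionModule.

Local Open Scope group_scope.
Local Open Scope ring_scope.

Import FiniteModule.

Variables (aT rT : finGroupType) (D : {group aT}) (R : {group rT}).
Variables (to : groupAction D R) (Q : {group aT}) (A : {group rT}).
Hypotheses (sQD : Q \subset D) (abA : abelian A).
Hypothesis nAQ : {acts Q, on group A | to}.

Local Notation V := (fmod_of abA).

(** The acting group is turned into the type [subg_of Q] so that the action is
    total, as the module lemmas require. *)
Definition mact (u : V) (q : subg_of Q) : V := fmod abA (to (fmval u) (sgval q)).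

Lemma fmval_mact u q : fmval (mact u q) = to (fmval u) (sgval q).
Proof. by rewrite /mact fmodK // (acts_act (proj1 nAQ)) ?subgP ?fmodP. Qed.

Lemma mact1 : mact^~ 1%g =1 id.
Proof. by move=> u; apply: fmod_inj; rewrite fmval_mact act1. Qed.

Lemma mactM u : act_morph mact u.
Proof.
move=> x y; apply: fmod_inj; rewrite !fmval_mact actMin ?(subsetP sQD) ?subgP //.
Qed.

Canonical mact_action := TotalAction mact1 mactM.

Lemma mactD x : {morph mact^~ x : u v / u + v}.
Proof.
move=> u v; apply: fmod_inj; rewrite fmvalA !fmval_mact fmvalA gactM.
- by congr (_ * _)%g; apply/esym/fmval_mact.
- by rewrite (subsetP sQD) ?subgP.
- by rewrite (subsetP (proj2 nAQ)) ?fmodP.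
by rewrite (subsetP (proj2 nAQ)) ?fmodP.
Qed.

(** The product over Q in the group rT, where commutativity is only known on A,
    is moved to the additive group before it is reindexed. *)
Lemma fmval_mtrace u :
  fmval (mtrace mact_action [set: subg_of Q] u) = trace to Q (fmval u).
Proof.
rewrite /mtrace fmval_sum /trace.
have QA q : q \in Q -> to (fmval u) q \in A.
  by move=> Qq; rewrite (acts_act (proj1 nAQ)) ?fmodP.
have -> : (\prod_(q in Q) to (fmval u) q)%g
        = fmval (\sum_(q in Q) fmod abA (to (fmval u) q)).
  by rewrite fmval_sum; apply: eq_bigr => q Qq; rewrite [RHS]fmodK ?QA.
rewrite -fmval_sum -{1}(im_sgval Q) morphimEdom; congr fmval.
rewrite big_imset /=; first by apply: eq_bigr => q _.
by move=> x y _ _; apply: val_inj.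
Qed.

Lemma Tate_H0_trivial :
  Tate_H0 to Q A = 1%g -> H0_trivial mact_action [set: subg_of Q].
Proof.
have [gT sTF] := trace_image_group sQD abA nAQ.
rewrite /Tate_H0 -[trace_image to Q A]/(gval (Group gT)) => H1.
have: ('Fix_(A | to)(Q) / Group gT)%g \subset [1]%g by rewrite H1.
rewrite quotient_sub1; last first.
  apply: subset_trans (subsetIl _ _) (sub_abelian_norm abA _).
  exact: subset_trans sTF (subsetIl _ _).
move=> sFT; apply/subsetP=> u /afixP fu.
have : fmval u \in 'Fix_(A | to)(Q).
  apply/setIP; split; [exact: fmodP | apply/afixP]=> q Qq.
  have := congr1 fmval (fu (subg Q q) (in_setT _)).
  by rewrite /= fmval_mact subgK.
case/(subsetP sFT)/imsetP=> a Aa def_u; apply/imsetP; exists (fmod abA a) => //.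
by apply: fmod_inj; rewrite fmval_mtrace fmodK.
Qed.

End ActionModule.

(** * Groups with trivial cohomology on the center of the Frattini subgroup *)

Section NSgroups.

Import FiniteModule.
Local Open Scope group_scope.

Variables (p : nat) (gT : finGroupType) (G : {group gT}).
Hypotheses (p_pr : prime p) (pG : p.-group G) (ncG : ~~ abelian G).
Hypothesis H0_1 : Tate_H0 ('J %% 'Phi(G))%gact (G / 'Phi(G)) 'Z('Phi(G)) = 1%g.

Local Notation A := ('Z('Phi(G)))%G.
Local Notation Q := (G / 'Phi(G))%G.
Local Notation to := ('J %% 'Phi(G))%gact.

Let abA : abelian A := center_abelian _.
Let nsAG : A <| G := gFnormal_trans _ (Phi_normal G).
Let nPG : G \subset 'N('Phi(G)) := gFnorm _ _.

Lemma Phi_quotient_sub : Q \subset [set: gT] / 'Phi(G).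
Proof. by rewrite quotientS ?subsetT. Qed.

Lemma Phi_acts : {acts Q, on group A | to}.
Proof.
split=> /=; last first.
  apply/subsetP=> a /centerP[_ cPa]; rewrite inE in_setT; apply/afixP=> x.
  by case/setIP=> _ Px; rewrite /= conjgE (cPa x Px) mulKg.
apply/subsetP=> x Qx; apply/setIP; split.
  exact: (subsetP Phi_quotient_sub).
rewrite inE.
apply/subsetP=> a Aa; rewrite inE; have [g _ Gg ->] := morphimP Qx.
by rewrite NS_actionE // memJ_norm ?(subsetP (normal_norm nsAG)).
Qed.

Local Notation V := (fmod_of abA).
Local Notation conjV := (mact_action Phi_quotient_sub abA Phi_acts).

Lemma NS_H0_trivial : H0_trivial conjV [set: subg_of Q].
Proof. exact: (Tate_H0_trivial Phi_quotient_sub abA Phi_acts H0_1). Qed.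

Lemma conjVD x : {morph conjV^~ x : u v / (u + v)%R}.
Proof. by move=> u v; exact: (mactD Phi_quotient_sub Phi_acts). Qed.

Lemma card_fmodA : #|[set: V]| = #|A|.
Proof.
rewrite -(card_imset [set: V] (@fmod_inj _ _ abA)); apply: eq_card => a.
apply/imsetP/idP=> [[u _ ->] | Aa]; first exact: fmodP.
by exists (fmod abA a); rewrite ?inE //; apply/esym/fmodK.
Qed.

Lemma card_subg_Phi_quotient : #|[set: subg_of Q]| = #|Q|.
Proof. by rewrite -(card_injm (injm_sgval Q) (subxx _)) im_sgval. Qed.

Let pA : p.-group A.
Proof. exact: pgroupS (normal_sub nsAG) pG. Qed.

Lemma p_group_fmodA : p.-group [set: V].
Proof. by rewrite /pgroup card_fmodA. Qed.

Lemma p_group_subg_Phi_quotient : p.-group [set: subg_of Q].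
Proof. by rewrite /pgroup card_subg_Phi_quotient; apply: quotient_pgroup. Qed.

Definition sub_coset x : subg_of Q := subg Q (coset 'Phi(G) x).

Lemma fmval_conjV u x : x \in G -> fmval (conjV u (sub_coset x)) = fmval u ^ x.
Proof.
move=> Gx; rewrite [LHS](fmval_mact Phi_acts) /sub_coset subgK ?mem_quotient //.
by rewrite NS_actionE ?fmodP.
Qed.

(** A norm is a quotient of n-th powers: this is how the cohomology of A controls
    p-th powers in a coset of A. *)
Lemma expgM_powsum u x n : x \in G ->
  (x * fmval u) ^+ n = x ^+ n * fmval (powsum conjV n (sub_coset x) u).
Proof.
move=> Gx; elim: n => [|n IHn]; first by rewrite /powsum big_ord0 mulg1.
have -> : powsum conjV n.+1 (sub_coset x) u
        = (conjV (powsum conjV n (sub_coset x) u) (sub_coset x) + u)%R.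
  rewrite /powsum big_ord_recl act1 addrC (to_sum conjVD); congr (_ + _)%R.
  by apply: eq_bigr => i _; rewrite -actM -expgSr.
rewrite fmvalA -[val (conjV _ _)]/(fmval _) fmval_conjV // !expgSr IHn.
suff mulJ (a b c d : gT) : a * b * (c * d) = a * c * (b ^ c * d) by apply: mulJ.
by rewrite conjgE !mulgA mulgK.
Qed.

Lemma H0_trivial_coset x : x \in G -> H0_trivial conjV <[sub_coset x]>.
Proof.
have pQ := p_group_subg_Phi_quotient; move=> Gx.
exact: H0_trivial_sub conjVD p_pr pQ p_group_fmodA _ _ (subsetT _) NS_H0_trivial.
Qed.

Let abelemQ : p.-abelem Q := Phi_quotient_abelem pG.

Lemma coset_expp x : x \in G -> x ^+ p \in 'Phi(G).
Proof.
move=> Gx; have Nx := subsetP nPG x Gx; have [_ Qp] := abelemP p_pr abelemQ.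
by apply: coset_idr; rewrite ?groupX // morphX // Qp ?mem_quotient.
Qed.

Lemma comm_Phi x y : x \in G -> y \in G -> [~ x, y] \in 'Phi(G).
Proof.
move=> Gx Gy; have [cQQ _] := abelemP p_pr abelemQ.
apply: (subsetP (_ : [~: G, G] \subset _)); last exact: mem_commg.
by rewrite -quotient_cents2.
Qed.

Lemma order_sub_coset x : x \in G -> x \notin 'Phi(G) -> #[sub_coset x] = p.
Proof.
move=> Gx P'x; have Qx : coset 'Phi(G) x \in Q by apply: mem_quotient.
have <- : #[sgval (sub_coset x)] = #[sub_coset x].
  by apply: (order_injm (injm_sgval Q)); rewrite inE.
rewrite /sub_coset subgK //.
apply: (abelem_order_p abelemQ Qx); apply: contra P'x => /eqP/coset_idr-> //.
exact: (subsetP nPG).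
Qed.

(** The element x ^+ p of A is fixed by x, hence is the norm of some u, and
    multiplying x by - u cancels its p-th power. *)
Lemma coset_Phi_expp1 x : abelian 'Phi(G) -> x \in G -> x \notin 'Phi(G) ->
  exists2 b, b \in 'Phi(G) & (x * b) ^+ p = 1.
Proof.
move=> abP Gx P'x; have defA := center_idP abP.
have Axp : x ^+ p \in A by rewrite /= defA coset_expp.
have ox := order_sub_coset Gx P'x.
have : fmod abA (x ^+ p) \in 'Fix_conjV(<[sub_coset x]>).
  rewrite afix_cycle; apply/afix1P/fmod_inj; rewrite fmval_conjV // fmodK //.
  by rewrite conjXg conjgE mulKg.
case/(subsetP (H0_trivial_coset Gx))/imsetP=> u _.
rewrite (mtrace_cycle conjVD) ?ox // => def_u.
exists (fmval (- u)%R); first by apply: (subsetP (center_sub _)); apply: fmodP.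
have -> : (- u)%R = (0 - u)%R by rewrite add0r.
have powsumN : powsum conjV p (sub_coset x) (0 - u)%R = (0 - fmod abA (x ^+ p))%R.
  apply/(addIr (fmod abA (x ^+ p)))/esym; rewrite subrK [X in (_ + X)%R]def_u.
  by rewrite -(powsumD conjVD) subrK /powsum big1 // => i _; rewrite (to0 conjVD).
by rewrite expgM_powsum // powsumN add0r fmvalN fmodK // mulgV.
Qed.

(** Since y ^+ p and its conjugate (y * [~ y, g]) ^+ p are both trivial, so is the
    norm of [~ y, g]; by [ker_powsum] this commutator lies in the image of
    a |-> [~ a, y]. *)
Lemma comm_expp1 y g : abelian 'Phi(G) -> y \in G -> y \notin 'Phi(G) ->
  y ^+ p = 1 -> g \in G -> [~ y, g] \in [~: A, G].
Proof.
move=> abP Gy P'y yp1 Gg; have defA := center_idP abP.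
have Ac : [~ y, g] \in A by rewrite /= defA comm_Phi.
set c := [~ y, g] in Ac *; pose v := fmod abA c.
have val_v : fmval v = c by apply: fmodK.
have oy := order_sub_coset Gy P'y.
have powsum0 : powsum conjV p (sub_coset y) v = 0%R.
  apply: fmod_inj; have := expgM_powsum v p Gy; rewrite yp1 mul1g => <-.
  by rewrite val_v /c -conjg_mulR -conjXg yp1 conj1g.
have /imsetP[u _ def_v] : v \in delta conjV (sub_coset y) @: [set: V].
  apply: (ker_powsum conjVD (n := p) (S := [set: V]%G)) => // [u _|u _||].
  - exact: in_setT.
  - by rewrite -oy expg_order act1.
  2: exact: in_setT.
  apply/subsetP=> u; rewrite inE => /andP[_ du0].
  have: u \in 'Fix_conjV(<[sub_coset y]>).
    by rewrite afix_cycle; apply/afix1P/eqP; rewrite -subr_eq0.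
  case/(subsetP (H0_trivial_coset Gy))/imsetP=> w _ ->.
  rewrite (mtrace_cycle conjVD) ?oy //.
  by rewrite imset_f ?inE.
have -> : c = [~ fmval u, y].
  rewrite -val_v def_v commgEl /delta addrC fmvalA fmvalN.
  by congr (_ * _); apply: fmval_conjV.
by rewrite mem_commg ?fmodP.
Qed.

(** If Phi(G) = A, then with the two preceding lemmas G / A0 is elementary abelian
    for any normal subgroup A0 of G of index p in A, which makes Phi(G) a subgroup
    of A0. *)
Lemma Phi_nonabelian : ~~ abelian 'Phi(G).
Proof.
apply/negP=> abP; have defA := center_idP abP.
have ntA : A :!=: 1.
  rewrite /= defA; apply: contraNneq ncG => Phi1.
  by have := trivg_Phi pG; rewrite Phi1 eqxx => /esym/abelem_abelian.
have [A0 [sA0A nsA0G oA0]] := normal_pgroup pG nsAG (leq_pred (logn p #|A|)).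
have oAb : #|A / A0| = p.
  rewrite card_quotient ?(subset_trans (normal_sub nsAG) (normal_norm nsA0G)) //.
  have := Lagrange sA0A; rewrite oA0 => eqA.
  have lA : 0 < logn p #|A|.
    rewrite lt0n; apply: contra ntA => /eqP l0.
    by rewrite trivg_card1 (card_pgroup pA) l0.
  have pk_gt0 : (0 < p ^ (logn p #|A|).-1)%N by rewrite expn_gt0 prime_gt0.
  apply/eqP; rewrite -(eqn_pmul2l pk_gt0).
  by rewrite eqA -expnSr prednK // -card_pgroup.
have nA0 := normal_norm nsA0G.
have sAbZ : A / A0 \subset 'Z(G / A0).
  have nsAb : A / A0 <| G / A0 by apply: quotient_normal.
  have ntAb : A / A0 != 1 by rewrite trivg_card1 oAb neq_ltn prime_gt1 ?orbT.
  have ntZ := meet_center_nil (pgroup_nil (quotient_pgroup A0 pG)) nsAb ntAb.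
  apply/setIidPl; apply: contraNeq ntZ => neZ.
  apply/eqP/prime_TIg; first by rewrite oAb.
  by apply: contra neZ => /setIidPl->.
have sAG0 : [~: A, G] \subset A0.
  rewrite -quotient_cents2 ?(subset_trans (normal_sub nsAG)) //.
  by rewrite subsetI in sAbZ; case/andP: sAbZ.
have expA b : b \in A -> b ^+ p \in A0.
  move=> Ab; have Nb := subsetP (subset_trans (normal_sub nsAG) nA0) b Ab.
  by apply: coset_idr; rewrite ?groupX // morphX // -oAb expg_cardG ?mem_quotient.
(* Modulo A0 every x agrees, up to the central image of A, with a central
   element of order dividing p; for x in A this element is 1. *)
have adjust x : x \in G -> exists b,
    [/\ b \in A, (x * b) ^+ p \in A0 & forall g, g \in G -> [~ x * b, g] \in A0].
  move=> Gx; have [Px | P'x] := boolP (x \in 'Phi(G)).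
    exists x^-1; rewrite mulgV expg1n group1 /= defA groupV; split=> // g _.
    by rewrite comm1g group1.
  have [b Pb xbp1] := coset_Phi_expp1 abP Gx P'x; have Gb := subsetP (Phi_sub G) b Pb.
  exists b; rewrite xbp1 group1 /= defA; split=> // g Gg.
  apply: (subsetP sAG0); apply: comm_expp1 => //; first exact: groupM.
  by rewrite groupMr.
have central x g : x \in A -> g \in G -> commute (coset A0 x) (coset A0 g).
  move=> Ax Gg; have /centerP[_] := subsetP sAbZ _ (mem_quotient A0 Ax).
  by apply; apply: mem_quotient.
have : 'Phi(G) \subset A0.
  apply: (Phi_min pG nA0); apply/(abelemP p_pr); split.
    apply/centsP=> _ /morphimP[x Nx Gx ->] _ /morphimP[g Ng Gg ->].
    have [b [Ab _ cxb]] := adjust x Gx; have Gb := subsetP (normal_sub nsAG) b Ab.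
    have Nb := subsetP nA0 b Gb.
    rewrite -(mulgK b x) morphM ?groupM ?groupV //.
    apply/commute_sym/commuteM; apply/commute_sym; last first.
      by apply: central; rewrite ?groupV.
    apply/commgP; rewrite -morphR ?groupM //; apply/eqP/coset_id.
    exact: cxb.
  move=> _ /morphimP[x Nx Gx ->].
  have [b [Ab xbp _]] := adjust x Gx; have Gb := subsetP (normal_sub nsAG) b Ab.
  have Nb := subsetP nA0 b Gb.
  rewrite -(mulgK b x) morphM ?groupM ?groupV //.
  rewrite expgMn; last by apply/commute_sym/central; rewrite ?groupV ?groupM.
  have -> : coset A0 (x * b) ^+ p = 1.
    by rewrite -morphX ?groupM //; apply: coset_id.
  rewrite -morphX ?groupV // mul1g; apply: coset_id.
  by rewrite expgVn groupV expA.
rewrite -{1}defA => /subset_leq_card; rewrite leqNgt -(Lagrange sA0A) => /negP[].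
rewrite ltn_Pmulr // -card_quotient ?oAb ?prime_gt1 //.
exact: subset_trans (normal_sub nsAG) nA0.
Qed.

(** Generators of G / Phi(G) lift to generators of G. *)
Lemma grank_le_logn_Phi_quotient : ('m(G) <= logn p #|Q|)%N.
Proof.
have [B genB oB] := grank_witness Q.
have <- : #|B| = logn p #|Q|.
  by rewrite oB grank_abelian ?(abelem_abelian abelemQ) // (rank_abelem abelemQ).
have sBQ : B \subset Q by rewrite -genB subset_gen.
pose X := [set repr (x : {set gT}) | x : coset_of 'Phi(G) in B].
have sXG : X \subset G.
  apply/subsetP=> _ /imsetP[x Bx ->].
  have : repr (x : {set gT}) \in coset 'Phi(G) @*^-1 Q.
    apply/morphpreP; split; first exact: repr_coset_norm.
    by rewrite /= coset_reprK (subsetP sBQ).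
  by rewrite quotientGK ?Phi_normal.
have sPX : 'Phi(G) \subset 'Phi(G) <*> X := joing_subl _ _.
have genX : <<X>> = G.
  apply: Phi_nongen; apply/eqP; rewrite eqEsubset join_subG Phi_sub sXG /=.
  rewrite -(quotientSGK nPG sPX).
  suff: <<B>> \subset ('Phi(G) <*> X) / 'Phi(G) by rewrite genB.
  rewrite gen_subG; apply/subsetP=> x Bx; rewrite -(coset_reprK x) mem_quotient //.
  by apply/mem_gen/setUP; right; apply: imset_f.
by rewrite -[X in 'm(X)]genX (leq_trans (grank_min _)) ?leq_imset_card.
Qed.

Theorem card_NS : (p ^ (2 * 'm(G) + p + 2) <= #|G|)%N.
Proof.
(* The bound on |A| needs |Q| > p, which holds as G is not cyclic. *)
have ncQ : ~~ cyclic Q.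
  by apply: contra ncG => /Phi_quotient_cyclic/cyclic_abelian.
have ltpQ : p < #|Q|.
  rewrite ltnNge; apply: contra ncQ => leQp.
  have [k oQ] := p_natP (abelem_pgroup abelemQ).
  case: k oQ => [|[|k]] oQ.
  - by rewrite (card1_trivg oQ) cyclic1.
  - by rewrite prime_cyclic ?oQ.
  by move: leQp; rewrite oQ -{2}(expn1 p) leq_exp2l ?prime_gt1.
have ntV : [set: V] != 1.
  apply: contraNneq Phi_nonabelian => V1.
  have /eqP := card_fmodA; rewrite V1 cards1 eq_sym -trivg_card1 => /eqP Z1.
  have := trivg_center_pgroup (pgroupS (Phi_sub G) pG) Z1.
  by move=> ->; apply: abelian1.
have abQ : p.-abelem [set: subg_of Q].
  by rewrite -(injm_abelem (injm_sgval Q)) ?subxx ?im_sgval.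
have pQ := p_group_subg_Phi_quotient.
have := card_H0_trivial_abelem conjVD p_pr pQ p_group_fmodA abQ.
rewrite -!cardsT card_fmodA card_subg_Phi_quotient => /(_ ltpQ ntV NS_H0_trivial) leA.
have lePA : p ^ 2 <= #|'Phi(G) / A|.
  have [k oPA] := p_natP (quotient_pgroup A (pgroupS (Phi_sub G) pG)).
  rewrite oPA (leq_exp2l _ _ (prime_gt1 p_pr)) leqNgt; apply/negP=> lek1.
  have : cyclic ('Phi(G) / A).
    case: k oPA lek1 => [|[|k]] oPA // _; first by rewrite (card1_trivg oPA) cyclic1.
    by rewrite prime_cyclic ?oPA.
  by move/(cyclic_factor_abelian (subxx _)); apply/negP: Phi_nonabelian.
have leQ : p ^ 'm(G) <= #|Q|.
  rewrite (card_pgroup (abelem_pgroup abelemQ)) leq_exp2l ?prime_gt1 //.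
  exact: grank_le_logn_Phi_quotient.
rewrite -(Lagrange (Phi_sub G)) -(Lagrange (center_sub 'Phi(G))).
rewrite -!card_quotient ?gFnorm //.
have -> : (2 * 'm(G) + p + 2 = p + 'm(G) + 2 + 'm(G))%N.
  rewrite mul2n -addnn [(p + _)%N]addnC -!addnA; congr (_ + _)%N.
  by rewrite addnC -addnA.
by rewrite !expnD !leq_mul // (leq_trans _ leA) // leq_mul2l leQ orbT.
Qed.

End NSgroups.

Theorem corollary1p3 (p m : nat) (gT : finGroupType) (G : {group gT}) :
  prime p -> NS_group p G -> 'm(G)%g = m ->
  (p ^ (2 * m + p + 2) <= #|G|)%N.
Proof. by move=> p_pr [pG ncG H0_1] <-; apply: card_NS. Qed.
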